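(* Let $k$ be a positive integer. If $G$ is a strongly edge-colored graph whose average degree satisfies $d(G)=\frac{1}{|V(G)|}\sum_{v\in V(G)} d(v)\geq 2k-1$, then $G$ contains a rainbow matching of size at least $k$ (i.e., $r(G)\ge k$).
   Context: All graphs are finite, simple and undirected. An edge-colored graph is strongly edge-colored if for each color, the set of edges of that color forms an induced matching in $G$ (in particular the coloring is proper). A rainbow matching is a matching in which no two edges have the same color, and $r(G)$ denotes the maximum size of a rainbow matching in $G$. *)

(* Defs.v *)
From mathcomp Require Import all_boot all_order all_algebra.

Set Implicit Arguments.
Unset Strict Implicit.
Unset Printing Implicit Defensive.

Record sgraph := SGraph {
  vertex :> finType;
  adj : rel vertex;
  adj_sym : symmetric adj;
  adj_irrefl : irreflexive adj
}.

Definition edges (G : sgraph) : {set {set G}} :=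
  [set [set x; y] | x in G, y in G & adj x y].

Definition degree (G : sgraph) (v : G) : nat := #|[set w | adj v w]|.

(* Equals 0 on the graph without vertices, since x / 0 = 0 in rat. *)
Definition avg_degree (G : sgraph) : rat :=
  ((\sum_(v : G) degree v)%N%:R / #|G|%:R)%R.

Definition matching (G : sgraph) (M : {set {set G}}) : bool :=
  (M \subset edges G) && trivIset M.

(* The subgraph of G induced by the vertices covered by M has edge set M. *)
Definition induced_matching (G : sgraph) (M : {set {set G}}) : bool :=
  matching M && [forall f in edges G, (f \subset cover M) ==> (f \in M)].

(* An edge-coloring is represented by a function on all vertex sets; only its
   values on the edges are ever used. *)
Definition color_class (G : sgraph) (C : eqType) (c : {set G} -> C) (a : C) :
    {set {set G}} :=
  [set f in edges G | c f == a].

Definition strong_edge_coloring (G : sgraph) (C : eqType) (c : {set G} -> C) :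
    Prop :=
  forall a : C, induced_matching (color_class c a).

Definition rainbow_matching (G : sgraph) (C : eqType) (c : {set G} -> C)
    (M : {set {set G}}) : bool :=
  matching M && [forall f in M, forall g in M, (f != g) ==> (c f != c g)].

Definition rainbow_number (G : sgraph) (C : eqType) (c : {set G} -> C) : nat :=
  \max_(M : {set {set G}} | rainbow_matching c M) #|M|.

(* Main.v *)
(** Induct on [k]. A vertex [v] of maximum degree has degree at least [2k-1],
    and deleting it lowers the average degree by less than 2, so [G - v] has a
    rainbow matching [M] of size [k-1]. Each edge [e] of [M] blocks at most two
    edges at [v]: those meeting [e], or those sharing its color. Indeed, if [v]
    is adjacent to an end of [e], then no edge at [v] disjoint from [e] has the
    color of [e], since color classes are induced; otherwise at most one edge
    at [v] has that color. Hence at most [2k-2] edges at [v] are blocked, and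
    one of the others extends [M]. *)

Require Import Defs.
From mathcomp Require Import all_boot all_order all_algebra.
From mathcomp Require Import zify.

Set Implicit Arguments.
Unset Strict Implicit.
Unset Printing Implicit Defensive.

Import Order.TTheory GRing.Theory Num.Theory.

Section Edges.

Variable G : sgraph.
Implicit Types (x y v w : G) (e f : {set G}) (S : {set G}).

Lemma edgesP e :
  reflect (exists x y, adj x y /\ e = [set x; y]) (e \in edges G).
Proof.
apply: (iffP imset2P) => [[x y _]|[x [y [xy ->]]]].
  by rewrite inE => /andP[_ xy] ->; exists x, y.
by exists x y; rewrite // inE.
Qed.

Lemma mem_edges x y : adj x y -> [set x; y] \in edges G.
Proof. by move=> xy; apply/edgesP; exists x, y. Qed.

Lemma adj_neq x y : adj x y -> x != y.
Proof. by apply: contraTneq => ->; rewrite adj_irrefl. Qed.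

Lemma card_edge e : e \in edges G -> #|e| = 2.
Proof. by move=> /edgesP[x [y [/adj_neq xy ->]]]; rewrite cards2 xy. Qed.

Lemma set0_notin_edges (M : {set {set G}}) : M \subset edges G -> set0 \notin M.
Proof.
by move=> /subsetP sM; apply/negP => /sM/card_edge; rewrite cards0.
Qed.

(** Neighbors are taken within a vertex set [S], so that deleting a vertex only shrinks [S] while
    the graph and its coloring stay fixed. *)
Definition nbhd S v : {set G} := [set w in S | adj v w].

Lemma nbhdD1 S v w : v \in S -> #|nbhd S w| = adj w v + #|nbhd (S :\ v) w|.
Proof.
move=> vS; rewrite (cardsD1 v) inE vS /=; congr (_ + _).
by apply: eq_card => u; rewrite !inE andbA.
Qed.

(** Each edge at [v] inside [S] is counted twice: in the term of [v] and in that of its other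
    end. *)
Lemma sum_nbhdD1 S v : v \in S ->
  \sum_(w in S) #|nbhd S w|
    = \sum_(w in S :\ v) #|nbhd (S :\ v) w| + 2 * #|nbhd S v|.
Proof.
move=> vS; rewrite (big_setD1 v) //=.
under eq_bigr do rewrite (nbhdD1 _ vS).
rewrite big_split /=.
have -> : \sum_(w in S :\ v) adj w v = #|nbhd S v|.
  rewrite -big_mkcondr /= sum1_card; apply: eq_card => w.
  rewrite unfold_in !inE [adj v w]adj_sym; case: eqVneq => //= ->.
  by rewrite adj_irrefl andbF.
lia.
Qed.

End Edges.

Section StrongColoring.

Variables (G : sgraph) (C : eqType) (c : {set G} -> C).
Hypothesis hc : strong_edge_coloring c.
Implicit Types (x y v w : G) (e f g : {set G}) (S : {set G}).

Lemma strong_disjoint e f : e \in edges G -> f \in edges G ->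
  c e = c f -> e != f -> [disjoint e & f].
Proof.
move=> eE fE cef nef; have /andP[/andP[_ /trivIsetP tI] _] := hc (c f).
by apply: tI => //; rewrite inE ?eE ?fE ?cef /=.
Qed.

Lemma strong_induced e f g : e \in edges G -> f \in edges G -> g \in edges G ->
  c e = c f -> g \subset e :|: f -> c g = c f.
Proof.
move=> eE fE gE cef sg; have /andP[_ /forall_inP ind] := hc (c f).
have: g \in color_class c (c f).
  apply: (implyP (ind g gE)); apply: subset_trans sg _; rewrite subUset.
  by rewrite !(bigcup_sup _ _) // inE ?eE ?fE ?cef /=.
by rewrite inE => /andP[_ /eqP].
Qed.

(** An edge at [v] is recorded by its other end [w]. *)
Definition blocked S v e : {set G} :=
  [set w in nbhd S v | (w \in e) || (c [set v; w] == c e)].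

Lemma card_blocked S v e : e \in edges G -> v \notin e -> #|blocked S v e| <= 2.
Proof.
move=> eE ve.
have neq w : [set v; w] != e.
  by apply: contraNneq ve => <-; rewrite set21.
have [/set0Pn[a] | /negPn/eqP B0] := boolP (blocked S v e :&: e != set0).
  (* Given a blocked [a] on [e], every blocked [w] lies on [e]. Otherwise [[set v; w]] has the color
     of [e], and inducedness gives that color to [[set v; a]], which meets [e] at [a]. *)
  rewrite !inE => /andP[/andP[/andP[_ va] _] ae].
  rewrite -(card_edge eE); apply/subset_leq_card/subsetP => w.
  rewrite !inE => /andP[/andP[_ vw] /orP[//|/eqP cvw]].
  have cva : c [set v; a] = c e.
    apply: (strong_induced (mem_edges vw) eE (mem_edges va) cvw).
    by apply/subsetP => u; rewrite !inE => /orP[]/eqP->; rewrite ?eqxx ?ae ?orbT.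
  have /disjointFr/(_ (set22 v a)) :=
    strong_disjoint (mem_edges va) eE cva (neq a).
  by rewrite ae.
(* With no blocked vertex on [e], all blocked edges have the color of [e]; sharing [v], they
   coincide. *)
have col w : w \in blocked S v e -> adj v w /\ c [set v; w] = c e.
  move=> wB; have := wB; rewrite !inE => /andP[/andP[_ vw]].
  case/orP => [we|/eqP//]; suff: w \in set0 by rewrite inE.
  by rewrite -B0 inE wB.
apply: leq_trans (_ : 1 <= 2) => //; apply/card_le1_eqP => x y.
move=> /col[vx cx] /col[vy cy].
have [exy|nxy] := eqVneq [set v; x] [set v; y].
  have: x \in [set v; y] by rewrite -exy set22.
  by rewrite !inE [x == v]eq_sym (negPf (adj_neq vx)) => /eqP.
have /disjointFr/(_ (set21 v x)) :=
  strong_disjoint (mem_edges vx) (mem_edges vy) (etrans cx (esym cy)) nxy.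
by rewrite set21.
Qed.

Lemma rainbow_extend M v w : rainbow_matching c M -> adj v w ->
    v \notin cover M -> w \notin cover M ->
    (forall e, e \in M -> c [set v; w] != c e) ->
  rainbow_matching c ([set v; w] |: M) /\ #|[set v; w] |: M| = #|M|.+1.
Proof.
case/andP => /andP[sM tM] rM vw vM wM new.
have dis : {in M, forall f, [disjoint [set v; w] & f]}.
  move=> f fM; rewrite disjoints_subset; apply/subsetP => u.
  rewrite !inE => /orP[]/eqP->.
    by apply: contra vM => vf; apply/bigcupP; exists f.
  by apply: contra wM => wf; apply/bigcupP; exists f.
have [tI nM] := trivIsetU1 dis tM (set0_notin_edges sM).
split; last by rewrite cardsU1 nM.
rewrite /rainbow_matching /matching tI subUset sub1set mem_edges // sM /=.
apply/forall_inP => f fM; apply/forall_inP => g gM; apply/implyP.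
move: fM gM; rewrite !in_setU1 => /predU1P[->|fM] /predU1P[->|gM] //.
- by rewrite eqxx.
- by move=> _; apply: new.
- by move=> _; rewrite eq_sym new.
- by apply/implyP; move/forall_inP/(_ f fM)/forall_inP: rM; apply.
Qed.

(** The bound states average degree at least [2 * k - 1] in the subgraph induced on [S], free of
    division and subtraction. Keeping [cover M] inside [S] leaves the deleted vertex uncovered. *)
Lemma rainbow_matching_in k S : S != set0 ->
    2 * k * #|S| <= \sum_(w in S) #|nbhd S w| + #|S| ->
  exists M, [/\ rainbow_matching c M, cover M \subset S & #|M| = k].
Proof.
elim: k S => [|k IHk] S S0 hS.
  exists set0; split; rewrite ?cards0 //; last by rewrite /cover big_set0 sub0set.
  rewrite /rainbow_matching /matching sub0set /=; apply/andP; split.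
    by apply/trivIsetP => A B; rewrite inE.
  by apply/forall_inP => f; rewrite inE.
have S_gt0 : 0 < #|S| by rewrite card_gt0.
(* The hypothesis for [k.+1] puts the average at [2 * k + 1] or more. *)
have [v vS dv] : exists2 v, v \in S & 2 * k < #|nbhd S v|.
  apply/exists_inP; apply/contraT; rewrite negb_exists_in => /forall_inP small.
  have: \sum_(w in S) #|nbhd S w| <= #|S| * (2 * k).
    rewrite -sum_nat_const; apply: leq_sum => w /small.
    by rewrite -leqNgt.
  nia.
have sN : nbhd S v \subset S :\ v.
  apply/subsetP => w; rewrite !inE => /andP[-> vw].
  by rewrite eq_sym adj_neq.
have dvS := subset_leq_card sN; have cS := cardsD1 v S; rewrite vS in cS.
have [||M [rM cM kM]] := IHk (S :\ v).
- by rewrite -card_gt0; lia.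
(* As [v] has at most [#|S| - 1] neighbors in [S], the degree sum drops by at most
   [2 * (#|S| - 1)]. *)
- have := sum_nbhdD1 vS; nia.
have /andP[/andP[/subsetP sM _] _] := rM.
have vM : v \notin cover M by apply/negP => /(subsetP cM); rewrite !inE eqxx.
have ve e : e \in M -> v \notin e.
  by move=> eM; apply: contra vM => ve; apply/bigcupP; exists e.
have cB : #|\bigcup_(e in M) blocked S v e| <= 2 * k.
  rewrite -kM mulnC -sum_nat_const.
  apply: (big_ind2 (fun (A : {set G}) n => #|A| <= n)).
  - by rewrite cards0.
  - move=> A m B n Am Bn; apply: leq_trans (leq_card_setU A B) _.
    exact: leq_add.
  - by move=> e eM; rewrite card_blocked ?sM ?ve.
(* More than [2 * k] neighbors face at most [2 * k] blocked ones. *)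
have /subsetPn[w wN wB] : ~~ (nbhd S v \subset \bigcup_(e in M) blocked S v e).
  by apply/negP => /subset_leq_card; lia.
have free e : e \in M -> ~~ ((w \in e) || (c [set v; w] == c e)).
  move=> eM; apply: contra wB => we; apply/bigcupP; exists e => //.
  by rewrite inE wN.
have [wS vw] : w \in S /\ adj v w by move: wN; rewrite inE => /andP[].
have [|e /free|rM' cM'] := rainbow_extend rM vw vM.
- by apply/bigcupP => -[e /free]; rewrite negb_or => /andP[/negP].
- by rewrite negb_or => /andP[].
exists ([set v; w] |: M); split; rewrite ?cM' ?kM //.
rewrite /cover bigcup_setU big_set1 subUset (subset_trans cM) ?subD1set // andbT.
by apply/subsetP => u; rewrite !inE => /orP[]/eqP->.
Qed.

End StrongColoring.

Theorem theorem4 (k : nat) (hk : (0 < k)%N) (G : sgraph) (C : eqType)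
    (c : {set G} -> C) (hc : strong_edge_coloring c)
    (hd : (2 * k%:R - 1 <= avg_degree G)%R) :
  (exists M : {set {set G}}, rainbow_matching c M /\ (k <= #|M|)%N) /\
  (k <= rainbow_number c)%N.
Proof.
suff [M [rM _ kM]] :
    exists M, [/\ rainbow_matching c M, cover M \subset [set: G] & #|M| = k].
  split; first by exists M; rewrite kM.
  by rewrite -kM; exact: (@leq_bigmax_cond _ _ (fun N : {set {set G}} => #|N|)).
have G_gt0 : 0 < #|G|.
  (* Without vertices [avg_degree] is 0 by convention, whereas [0 < k] makes the lower bound
     positive. *)
  rewrite lt0n; apply: contraTneq hd => G0.
  rewrite /avg_degree G0 invr0 mulr0 -ltNge subr_gt0 -natrM ltr1n; lia.
apply: rainbow_matching_in => //; first by rewrite -card_gt0 cardsT.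
move: hd; rewrite /avg_degree ler_pdivlMr ?ltr0n // mulrBl mul1r lerBlDr.
rewrite -!natrM -natrD ler_nat cardsT => hd; apply: leq_trans hd _.
rewrite leq_add2r; apply: eq_leq; apply: eq_big => [v|v _]; first by rewrite inE.
by apply: eq_card => w; rewrite !inE.
Qed.
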